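(* Let $0<q<1$ and $t>0$. The operator $(J,\mathcal D)$ on $\ell^2(\mathbb Z)$ defined by $$Je_k=a_ke_{k+1}+b_ke_k+a_{k-1}e_{k-1},\qquad a_k=\frac1{\sqrt{tq^{k+1}}},\quad b_k=-\frac1{tq^k},\qquad k\in\mathbb Z,$$ is essentially self-adjoint.
   Context: $\{e_k\}_{k\in\mathbb Z}$ is the standard orthonormal basis of $\ell^2(\mathbb Z)$ and $\mathcal D\subset\ell^2(\mathbb Z)$ is the subspace of finite linear combinations of the $e_k$; $J$ is extended linearly to $\mathcal D$. (This $J$ is unitarily equivalent to the $q$-difference operator $(Lf)(x)=f(xq)-\frac1xf(x)+\frac1xf(x/q)$ on finitely supported functions in $L^2(\mu_t)$, where $\mu_t=\sum_{k\in\mathbb Z}m_t(k)\delta_{tq^k}$ with $m_t(k)>0$ and $m_t(k+1)=tq^{k+1}m_t(k)$, via the unitary map $Uf=\sum_{k}f(tq^k)\sqrt{m_t(k)}\,e_k$.) *)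

(* Defs.v *)
From HB Require Import structures.
From mathcomp Require Import all_boot all_order all_algebra all_real_closed.
From mathcomp Require Import all_classical all_reals all_analysis.
From mathcomp Require Import ring lra.

Set Implicit Arguments.
Unset Strict Implicit.
Unset Printing Implicit Defensive.

Import Order.TTheory GRing.Theory Num.Theory numFieldNormedType.Exports.
Import ComplexField.Normc.

Local Open Scope classical_set_scope.
Local Open Scope complex_scope.
Local Open Scope ring_scope.

Section two_sided_series.
Context {R : realType}.
Implicit Types u v : int -> R.

(* A two-sided series is split into its terms of index [n >= 0] and
   [Negz n = - n.+1 < 0]; it converges when both halves do. *)
Definition cvgZ u : Prop :=
  cvgn (series (u \o Posz)) /\ cvgn (series (u \o Negz)).

Definition sumZ u : R :=
  limn (series (u \o Posz)) + limn (series (u \o Negz)).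

Lemma series_lin (c : R) (f g : R ^nat) :
  series (fun n => c * f n + g n) = (fun n => c * series f n + series g n).
Proof.
apply/funext => n; rewrite /series/= mulr_sumr -big_split/=; exact: eq_bigr.
Qed.

Lemma cvgZ_lin (c : R) u v :
  cvgZ u -> cvgZ v -> cvgZ (fun k => c * u k + v k).
Proof.
by move=> [u1 u2] [v1 v2]; split; rewrite /comp/= series_lin;
  apply: is_cvgD => //; apply: is_cvgM => //; exact: is_cvg_cst.
Qed.

Lemma sumZ_lin (c : R) u v : cvgZ u -> cvgZ v ->
  sumZ (fun k => c * u k + v k) = c * sumZ u + sumZ v.
Proof.
move=> [u1 u2] [v1 v2].
have C (f : R ^nat) : cvgn f -> (c * f n) @[n --> \oo] --> c * limn f.
  by move=> cf; apply: cvgM => //; exact: cvg_cst.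
have L (f g : R ^nat) : cvgn f -> cvgn g ->
    limn (fun n => c * f n + g n) = c * limn f + limn g.
  by move=> cf cg; apply: cvg_lim => //; apply: cvgD => //; exact: C.
rewrite /sumZ /comp/= !series_lin !L//.
by rewrite mulrDr addrACA.
Qed.

Lemma cvgZ_dom u v : (forall k, `|u k| <= v k) -> cvgZ v -> cvgZ u.
Proof.
move=> uv [v1 v2].
have D (f g : R ^nat) : (forall n, `|f n| <= g n) ->
    cvgn (series g) -> cvgn (series f).
  move=> fg cg; apply: (@normed_cvg _ R^o).
  apply: series_le_cvg cg => [n|n|n]; first exact: normr_ge0.
  - exact: le_trans (normr_ge0 _) (fg n).
  - exact: fg.
split; [apply: (D _ _ _ v1)|apply: (D _ _ _ v2)] => n; exact: uv.
Qed.

Lemma cvgZ_fin (N : nat) u :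
  (forall k : int, (N <= `|k|)%N -> u k = 0) -> cvgZ u.
Proof.
move=> u0.
have F (f : R ^nat) : (forall n, (N <= n)%N -> f n = 0) -> cvgn (series f).
  move=> f0; apply: (cvgP (series f N)); apply: cvg_near_cst.
  near=> n; rewrite /series/= (@big_cat_nat _ _ _ N)//=; last first.
    by near: n; exact: nbhs_infty_ge.
  rewrite [X in _ + X]big_nat_cond [X in _ + X]big1 ?addr0// => i /andP[/andP[Ni _] _].
  exact: f0.
split; apply: F => n Nn; apply: u0; first by rewrite absz_nat.
by rewrite NegzE abszN absz_nat; exact: leqW.
Unshelve. all: by end_near. Qed.

Lemma cvgZ0 : cvgZ (fun=> 0).
Proof. exact: (@cvgZ_fin 0%N). Qed.

Lemma sumZ0 : sumZ (fun=> 0) = 0.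
Proof.
have /= := sumZ_lin 1 cvgZ0 cvgZ0; rewrite mul1r addr0 => /esym/eqP.
by rewrite mul1r -subr_eq0 addrK => /eqP.
Qed.

Lemma sumZ_ge u k : (forall j, 0 <= u j) -> cvgZ u -> u k <= sumZ u.
Proof.
move=> u0 [u1 u2].
have G (f : R ^nat) : (forall n, 0 <= f n) -> cvgn (series f) ->
    forall n, f n <= limn (series f).
  move=> f0 cf n; have/(_ _ cf n.+1) le_lim := @nondecreasing_cvgn_le R (series f).
  apply: le_trans (le_lim _).
    by rewrite /series/= big_nat_recr//= lerDr sumr_ge0.
  by apply/nondecreasing_seqP => m; rewrite /series/= big_nat_recr//= lerDl.
have P (f : R ^nat) : (forall n, 0 <= f n) -> cvgn (series f) ->
    0 <= limn (series f).
  by move=> f0 cf; apply: le_trans (G f f0 cf 0%N).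
case: k => n.
- rewrite -[u _]addr0 lerD//.
  + by apply: (G (u \o Posz)) => // m; exact: u0.
  + by apply: (P (u \o Negz)) => // m; exact: u0.
- rewrite -[u _]add0r lerD//.
  + by apply: (P (u \o Posz)) => // m; exact: u0.
  + by apply: (G (u \o Negz)) => // m; exact: u0.
Qed.

End two_sided_series.

Section complex_series.
Context {R : realType}.
Implicit Types u v : int -> R[i].

Definition cvgZc u : Prop :=
  cvgZ (fun k => complex.Re (u k)) /\ cvgZ (fun k => complex.Im (u k)).

Definition sumZc u : R[i] :=
  sumZ (fun k => complex.Re (u k)) +i* sumZ (fun k => complex.Im (u k)).

Lemma sumZc_lin (c : R[i]) u v : cvgZc u -> cvgZc v ->
  sumZc (fun k => c * u k + v k) = c * sumZc u + sumZc v.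
Proof.
move: c => [a b] [u1 u2] [v1 v2].
have -> : sumZc (fun k => (a +i* b) * u k + v k) =
    sumZ (fun k => a * complex.Re (u k)
                   + (- b * complex.Im (u k) + complex.Re (v k)))
    +i* sumZ (fun k => a * complex.Im (u k)
                   + (b * complex.Re (u k) + complex.Im (v k))).
  rewrite /sumZc; congr (_ +i* _); congr sumZ; apply/funext => k;
    case: (u k) (v k) => [x y] [z w] /=.
  - by rewrite mulNr addrA.
  - by rewrite addrA.
rewrite !sumZ_lin//; try exact: cvgZ_lin.
by rewrite /sumZc; simpc; congr (_ +i* _); rewrite /= !addrA.
Qed.

Lemma sumZc_conj u : cvgZc u -> sumZc (fun k => (u k)^*) = (sumZc u)^*.
Proof.
move=> [u1 u2]; rewrite /sumZc/=; congr (_ +i* _).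
  by congr sumZ; apply/funext => k; case: (u k).
have := sumZ_lin (-1) u2 cvgZ0; rewrite sumZ0 addr0 mulN1r => <-.
by congr sumZ; apply/funext => k; case: (u k) => x y /=; rewrite addr0 mulN1r.
Qed.

End complex_series.

Definition square_summable {R : realType} (f : int -> R[i]) : Prop :=
  cvgZ (fun k => normc (f k) ^+ 2).

Definition ell2_pred {R : realType} : {pred int -> R[i]} :=
  mem [set f | square_summable f].

Record ell2 (R : realType) := Ell2 {
  ell2_fun :> int -> R[i];
  _ : ell2_fun \in ell2_pred }.

HB.instance Definition _ (R : realType) := [isSub for @ell2_fun R].
HB.instance Definition _ (R : realType) := [Choice of ell2 R by <:].

Section ell2_lmod.
Context {R : realType}.
Implicit Types f g : ell2 R.

Lemma sqr_normc (z : R[i]) :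
  normc z ^+ 2 = complex.Re z ^+ 2 + complex.Im z ^+ 2.
Proof. by case: z => x y /=; rewrite sqr_sqrtr// addr_ge0 ?sqr_ge0. Qed.

Lemma ell2_submod_closed : submod_closed (@ell2_pred R).
Proof.
split=> [|a f g]; rewrite !inE /=.
  by apply: (@cvgZ_fin _ 0%N) => k _; rewrite normc0 expr0n.
move=> sf sg.
have cg := cvgZ_lin 2 sg cvgZ0.
apply: cvgZ_dom (cvgZ_lin (2 * normc a ^+ 2) sf cg) => k /=.
rewrite ger0_norm ?sqr_ge0// addr0.
have le1 : normc (a * f k + g k) <= normc a * normc (f k) + normc (g k).
  by rewrite -normcM; exact: le_normcD.
have normc_ge0 (z : R[i]) : 0 <= normc z by case: z => x y; exact: sqrtr_ge0.
apply: (@le_trans _ _ ((normc a * normc (f k) + normc (g k)) ^+ 2)).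
  by rewrite ler_sqr// nnegrE ?addr_ge0 ?mulr_ge0.
rewrite -subr_ge0.
have -> : 2 * normc a ^+ 2 * normc (f k) ^+ 2 + 2 * normc (g k) ^+ 2
  - (normc a * normc (f k) + normc (g k)) ^+ 2
  = (normc a * normc (f k) - normc (g k)) ^+ 2 by ring.
exact: sqr_ge0.
Qed.

HB.instance Definition _ :=
  GRing.isSubmodClosed.Build _ _ (@ell2_pred R) ell2_submod_closed.
HB.instance Definition _ := [SubChoice_isSubLmodule of ell2 R by <:].

Lemma ell2P f : square_summable f.
Proof. by case: f => f /= /set_mem. Qed.

(* The convergence of both real series is [ell2_mul_cvg] below; the inner
   product is linear in its first argument. *)
Definition ell2_dot f g : R[i] := sumZc (fun k => f k * (g k)^*).

Lemma ell2_mul_cvg f g : cvgZc (fun k => f k * (g k)^*).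
Proof.
have cv : cvgZ (fun k => 1 * normc (f k) ^+ 2 + normc (g k) ^+ 2).
  exact: cvgZ_lin (ell2P f) (ell2P g).
split; apply: cvgZ_dom cv => k; rewrite mul1r !sqr_normc;
  case: (f k) (g k) => [x y] [z w] /=; rewrite ler_norml; apply/andP;
  move: (sqr_ge0 (x + z)) (sqr_ge0 (x - z)) (sqr_ge0 (y + w)) (sqr_ge0 (y - w))
    (sqr_ge0 (x + w)) (sqr_ge0 (x - w)) (sqr_ge0 (y + z)) (sqr_ge0 (y - z))
    (sqr_ge0 x) (sqr_ge0 y) (sqr_ge0 z) (sqr_ge0 w);
  rewrite !expr2 => *; split; lra.
Qed.

Lemma ell2_dotC f g : ell2_dot f g = (-1) ^+ false * (ell2_dot g f)^*%R.
Proof.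
rewrite mul1r -[RHS](sumZc_conj (ell2_mul_cvg g f)).
congr sumZc; apply/funext => k; rewrite rmorphM mulrC; congr (_ * _).
by rewrite [RHS]conjcK.
Qed.

Lemma ell2_dot_linl g : linear_for *%R (ell2_dot^~ g).
Proof.
move=> c f h; rewrite -[RHS](sumZc_lin c (ell2_mul_cvg f g) (ell2_mul_cvg h g)).
by congr sumZc; apply/funext => k; rewrite /= mulrDl mulrA.
Qed.

Lemma ell2_dot_bilinear : bilinear_for
  (GRing.Scale.Law.clone _ _ *%R _) (GRing.Scale.Law.clone _ _ (Num.conj \; *%R) _)
  ell2_dot.
Proof.
split=> [g|f] c u v; first exact: ell2_dot_linl.
rewrite ell2_dotC ell2_dot_linl !mul1r rmorphD rmorphM/=.
by rewrite [ell2_dot f u]ell2_dotC [ell2_dot f v]ell2_dotC !mul1r.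
Qed.

HB.instance Definition _ := bilinear_isBilinear.Build R[i] (ell2 R) (ell2 R)
  R[i] _ _ ell2_dot ell2_dot_bilinear.

HB.instance Definition _ := isHermitianSesquilinear.Build R[i] (ell2 R)
  false Num.conj ell2_dot ell2_dotC.

Lemma ell2_dotE f : ell2_dot f f = (sumZ (fun k => normc (f k) ^+ 2))%:C.
Proof.
rewrite /ell2_dot /sumZc; congr (_ +i* _).
  congr sumZ; apply/funext => k; rewrite sqr_normc.
  by case: (f k) => x y /=; rewrite mulrN opprK !expr2.
rewrite -[RHS]sumZ0.
congr sumZ; apply/funext => k.
by case: (f k) => x y /=; rewrite mulrN mulrC addNr.
Qed.

Lemma ell2_dot_gt0 f : f != 0 -> 0 < ell2_dot f f.
Proof.
move=> f0; have [k fk] : exists k, f k != 0.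
  apply: contrapT => /forallNP f0'; case/eqP: f0; apply/val_inj/funext => k /=.
  by apply/eqP/negPn/negP => ?; exact: (f0' k).
rewrite ell2_dotE ltcR.
apply: lt_le_trans (sumZ_ge k _ (ell2P f)); last by move=> j; exact: sqr_ge0.
rewrite lt_def sqr_ge0 andbT sqrf_eq0; apply: contra fk => /eqP fk.
by apply/eqP/eq0_normc.
Qed.

HB.instance Definition _ := isDotProduct.Build R[i] (ell2 R) ell2_dot
  ell2_dot_gt0.

End ell2_lmod.

Section dot_norm.
Context {C : numClosedFieldType} {U : lmodType C} (form : {dot U for Num.conj}).

Lemma dot_CauchySchwarz (u v : U) :
  `|form u v| <= sqrtC (form u u) * sqrtC (form v v).
Proof.
have [->|v0] := eqVneq v 0; first by rewrite !linear0r normr0 sqrtC0 mulr0.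
have vv : 0 < form v v by rewrite dnorm_gt0.
rewrite -(sqrCK (normr_ge0 _)) -sqrtCM ?nnegrE ?dnorm_ge0//.
rewrite ler_sqrtC ?nnegrE ?exprn_ge0 ?mulr_ge0 ?dnorm_ge0//.
pose a := form u v / form v v; pose w := u - a *: v.
have ow : form w v = 0.
  by rewrite linearBl/= linearZl_LR divfK ?subrr// gt_eqF.
have uE : form u u = form w w + `|a| ^+ 2 * form v v.
  rewrite -dnormZ -{1 2}(subrK (a *: v) u) -/w hnormDd//.
  by rewrite linearZr_LR/= ow mulr0.
rewrite uE mulrDl (_ : _ * _ * _ = `|form u v| ^+ 2) ?lerDr ?mulr_ge0 ?dnorm_ge0//.
have vn : form v v = `|form v v| by rewrite gtr0_norm.
by rewrite -mulrA -expr2 vn -exprMn -normrM divfK// gt_eqF.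
Qed.

Lemma dot_ler_normD (u v : U) :
  sqrtC (form (u + v) (u + v)) <= sqrtC (form u u) + sqrtC (form v v).
Proof.
rewrite -ler_sqr ?nnegrE ?addr_ge0 ?sqrtC_ge0 ?dnorm_ge0// sqrrD !sqrtCK.
rewrite dnormD/= addrAC lerD2r lerD2l.
set d := form u v.
have -> : d + d^*%R = 'Re d *+ 2.
  by rewrite -mulr_natr ReE divfK// pnatr_eq0.
rewrite lerMn2r/=; apply: le_trans (dot_CauchySchwarz u v).
exact: leif_Re_Creal.
Qed.

End dot_norm.

Section ell2_normed.
Context {R : realType}.
Implicit Types f g : ell2 R.

Definition ell2_norm f : R[i] := sqrtC (ell2_dot f f).

Lemma ell2_ler_normD f g : ell2_norm (f + g) <= ell2_norm f + ell2_norm g.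
Proof. exact: dot_ler_normD. Qed.

Lemma ell2_normrZ (c : R[i]) f : ell2_norm (c *: f) = `|c| * ell2_norm f.
Proof.
rewrite /ell2_norm dnormZ sqrtCM ?nnegrE ?exprn_ge0 ?dnorm_ge0//.
by rewrite sqrCK.
Qed.

Lemma ell2_normr0_eq0 f : ell2_norm f = 0 -> f = 0.
Proof. by move/eqP; rewrite sqrtC_eq0 dnorm_eq0 => /eqP. Qed.

HB.instance Definition _ := Lmodule_isNormed.Build R[i] (ell2 R)
  ell2_ler_normD ell2_normrZ ell2_normr0_eq0.

End ell2_normed.

Section unbounded_operators.
Context {R : realType}.
Local Notation H := (ell2 R).

Record operator := Operator {
  dom : set H;
  opval :> H -> H;
  dom0 : dom 0;
  dom_lin : forall (c : R[i]) f g, dom f -> dom g -> dom (c *: f + g);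
  op_lin : forall (c : R[i]) f g, dom f -> dom g ->
    opval (c *: f + g) = c *: opval f + opval g }.

Implicit Types T S : operator.

(* The values of an operator outside its domain are irrelevant: two operators
   are the same when they have the same graph. *)
Definition graph T : set (H * H) := [set p | dom T p.1 /\ p.2 = T p.1].

Definition densely_defined T := dense (dom T).

Definition symmetric_op T := densely_defined T /\
  forall f g, dom T f -> dom T g -> ell2_dot (T f) g = ell2_dot f (T g).

(* The graph of the adjoint [T^*] when [T] is densely defined *)
Definition adjoint_graph T : set (H * H) :=
  [set p | forall f, dom T f -> ell2_dot (T f) p.1 = ell2_dot f p.2].

Definition self_adjoint T :=
  densely_defined T /\ graph T = adjoint_graph T.

(* [S] is the closure of [T]: for such an [S] to exist, [T] must be closable. *)
Definition is_closure T S := graph S = closure (graph T).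

Definition essentially_self_adjoint T :=
  symmetric_op T /\ exists S, is_closure T S /\ self_adjoint S.

End unbounded_operators.
Arguments operator : clear implicits.

Section jacobi.
Context {R : realType}.
Variables q t : R.

Definition delta (k : int) : int -> R[i] := fun j => (j == k)%:R.

Lemma delta_ell2 k : delta k \in @ell2_pred R.
Proof.
rewrite inE /=; apply: (@cvgZ_fin _ `|k|.+1) => j kj.
rewrite /delta; case: eqP kj => [->|_ _]; first by rewrite ltnn.
by rewrite normc0 expr0n.
Qed.

Definition ell2_e (k : int) : ell2 R := Ell2 (delta_ell2 k).

Definition finite_combinations : set (ell2 R) :=
  [set f | exists s : seq (R[i] * int), f = \sum_(p <- s) p.1 *: ell2_e p.2].

Definition jacobi_a (k : int) : R := (Num.sqrt (t * q ^ (k + 1)))^-1.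
Definition jacobi_b (k : int) : R := - (t * q ^ k)^-1.

Definition jacobi_e (k : int) : ell2 R :=
  (jacobi_a k)%:C *: ell2_e (k + 1) + (jacobi_b k)%:C *: ell2_e k
  + (jacobi_a (k - 1))%:C *: ell2_e (k - 1).

(* The linear extension of [ell2_e k |-> jacobi_e k]: the sum is finite for [f]
   in [finite_combinations], as [f k] is the coefficient of [ell2_e k] in [f]. *)
Definition jacobi_fun (f : ell2 R) : ell2 R :=
  \sum_(k \in [set: int]) f k *: jacobi_e k.

Lemma ell2_sumE (s : seq (R[i] * int)) (k : int) :
  (\sum_(p <- s) p.1 *: ell2_e p.2 : ell2 R) k =
  \sum_(p <- s) p.1 * (k == p.2)%:R.
Proof.
elim: s => [|p s IH]; first by rewrite !big_nil.
by rewrite !big_cons -IH.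
Qed.

Lemma jacobi_funE (r : seq int) (f : ell2 R) : uniq r ->
  (forall k, k \notin r -> f k = 0) ->
  jacobi_fun f = \sum_(k <- r) f k *: jacobi_e k.
Proof.
move=> ur fr; rewrite /jacobi_fun (fsbigE r)// => [|k _].
  by apply: eq_bigl => k; rewrite in_setT.
by move=> /fr ->; rewrite scale0r.
Qed.

Lemma finite_combinations_supp f : finite_combinations f ->
  exists r : seq int, forall k, k \notin r -> f k = 0.
Proof.
move=> [s ->]; exists [seq p.2 | p <- s] => k ks.
rewrite ell2_sumE big_seq big1// => p ps.
by case: eqP ks => [->|_ _]; [rewrite map_f | rewrite mulr0].
Qed.

Lemma finite_combinations_lin (c : R[i]) f g : finite_combinations f ->
  finite_combinations g -> finite_combinations (c *: f + g).
Proof.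
move=> [s ->] [s' ->]; exists ([seq (c * p.1, p.2) | p <- s] ++ s').
rewrite big_cat big_map scaler_sumr/=; congr (_ + _).
by apply: eq_bigr => p _; rewrite scalerA.
Qed.

Lemma jacobi_fun_lin (c : R[i]) f g : finite_combinations f ->
  finite_combinations g -> jacobi_fun (c *: f + g) = c *: jacobi_fun f + jacobi_fun g.
Proof.
move=> /finite_combinations_supp[r fr] /finite_combinations_supp[s gs].
have ur := undup_uniq (r ++ s).
have fr' k : k \notin undup (r ++ s) -> f k = 0.
  by rewrite mem_undup mem_cat negb_or => /andP[/fr].
have gs' k : k \notin undup (r ++ s) -> g k = 0.
  by rewrite mem_undup mem_cat negb_or => /andP[_ /gs].
rewrite (jacobi_funE ur fr') (jacobi_funE ur gs') (jacobi_funE ur); last first.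
  move=> k ks; rewrite -[LHS]/(c * f k + g k) fr'// gs'//.
  by rewrite mulr0 addr0.
rewrite scaler_sumr -big_split/=; apply: eq_bigr => k _.
by rewrite scalerA -scalerDl.
Qed.

Lemma finite_combinations0 : finite_combinations 0.
Proof. by exists [::]; rewrite big_nil. Qed.

Definition jacobi : operator R :=
  Operator finite_combinations0 finite_combinations_lin jacobi_fun_lin.

Lemma finite_combinations_e k : finite_combinations (ell2_e k).
Proof. by exists [:: (1, k)]; rewrite big_seq1 scale1r. Qed.

Lemma jacobi_ell2_e k : jacobi (ell2_e k) = jacobi_e k.
Proof.
rewrite -[LHS]/(jacobi_fun _) (@jacobi_funE [:: k])// => [|j].
  by rewrite big_seq1 /= /delta eqxx scale1r.
by rewrite inE /= /delta => /negPf ->.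
Qed.

End jacobi.

(* Main.v *)
Require Import Defs.
From mathcomp Require Import all_boot all_order all_algebra all_real_closed.
From mathcomp Require Import all_classical all_reals all_analysis.
From mathcomp Require Import ring.

Set Implicit Arguments.
Unset Strict Implicit.
Unset Printing Implicit Defensive.

Import Order.TTheory GRing.Theory Num.Theory numFieldNormedType.Exports.
Import ComplexField.Normc Defs.

Local Open Scope classical_set_scope.
Local Open Scope complex_scope.
Local Open Scope ring_scope.

(** Write [d k = (t q^k)^(-1/2)], so that [a_k = d (k+1)], [b_k = - d k ^ 2],
    and [d (k+1) = r * d k] with [r = q^(-1/2)].  Then
      [(J f)_k = d (k+1) f (k+1) + d k f (k-1) - d k ^ 2 f k].
    The off-diagonal entries are only of the size of the square root of the
    diagonal ones, so where the entries are large the diagonal dominates, and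
    where they are small the operator is bounded.

    This is made precise by an a priori estimate for the maximal operator, the
    one given by the formula above on all [f] for which the result [g] lies in
    l^2.  Adding [d k f k] to the identity [d k ^ 2 f k = ... - g k] and
    dividing by [1 + d k] gives
      [d k f k = d k / (1 + d k) * (f k + r f (k+1) + f (k-1))
                 - g k / (1 + d k)],
    whose multipliers are at most 1, so [d f] is in l^2
    ([jacobi_weight_ell2]).  The identity
      [d k ^ 2 f k = d (k+1) f (k+1) + r d (k-1) f (k-1) - g k]
    then puts [d^2 f] in l^2 ([jacobi_weight2_ell2]).

    Hence each of the three terms of [J f] is separately in l^2, and truncating
    [f] to a finite window truncates each of the three, up to a shift: if [f_N]
    is the truncation, then [f_N --> f] and [J f_N --> g].  So the maximal
    operator lies in the closure of [J] ([maximal_sub_closure]).  Conversely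
    the relation between [f] and [g] reads [<f, J e_k> = <g, e_k>] for all
    [k], which survives limits, so the maximal operator is the closure of [J]
    ([jacobi_max_closure]).  It is also the adjoint of [J] by the same reading;
    being the closure of a symmetric operator it is symmetric, and therefore
    self-adjoint ([jacobi_max_self_adjoint]). *)

(** * Two-sided series: shifts and finite windows *)

Section two_sided_series_shift.
Context {R : realType}.
Implicit Types u : int -> R.

(** A forward shift moves the term [u 0] from the nonnegative to the negative
    half of the series and changes nothing else. *)
Lemma sumZ_shift1 u : cvgZ u ->
  cvgZ (fun k => u (k + 1)) /\ sumZ (fun k => u (k + 1)) = sumZ u.
Proof.
move=> [u1 u2].
set v := fun k => u (k + 1).
have P : series (v \o Posz) @ \oo --> - u 0 + limn (series (u \o Posz)).
  have -> : series (v \o Posz) = fun n => - u 0 + series (u \o Posz) n.+1.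
    apply/funext => n; rewrite /series/= big_nat_recl//= addKr.
    by apply: eq_bigr => i _; rewrite /v addrC.
  by apply: cvgD; [exact: cvg_cst | rewrite (cvg_shiftS (series _))].
have N : series (v \o Negz) @ \oo --> u 0 + limn (series (u \o Negz)).
  rewrite -cvg_shiftS.
  have -> : [sequence series (v \o Negz) n.+1]_n =
      fun n => u 0 + series (u \o Negz) n.
    apply/funext => n; rewrite /series/= big_nat_recl//=; congr (_ + _).
    apply: eq_bigr => i _; rewrite /v; congr u.
    by rewrite !NegzE (intS i.+1) opprD addrC addrA subrr add0r.
  by apply: cvgD => //; exact: cvg_cst.
split; first by split; apply/cvg_ex; eexists; [exact: P | exact: N].
by rewrite /sumZ (cvg_lim _ P)// (cvg_lim _ N)//; ring.
Qed.

(** The reflection [k |-> - k - 1] exchanges the two halves of the series, so it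
    turns a forward shift into a backward one. *)
Lemma sumZ_reflect u : cvgZ u ->
  cvgZ (fun k => u (- k - 1)) /\ sumZ (fun k => u (- k - 1)) = sumZ u.
Proof.
move=> [u1 u2].
have P : (fun k => u (- k - 1)) \o Posz = u \o Negz.
  by apply/funext => n /=; rewrite NegzE intS opprD addrC.
have N : (fun k => u (- k - 1)) \o Negz = u \o Posz.
  by apply/funext => n /=; rewrite NegzE opprK intS addrC addKr.
by rewrite /cvgZ /sumZ P N addrC.
Qed.


Lemma sumZ_shift (m : int) u : cvgZ u ->
  cvgZ (fun k => u (k + m)) /\ sumZ (fun k => u (k + m)) = sumZ u.
Proof.
move=> cu; elim: m => [|n [IHc IHs]|n [IHc IHs]].
- by under eq_fun do rewrite addr0.
- have -> : (fun k : int => u (k + n.+1%:Z)) = (fun k => u (k + 1 + n%:Z)).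
    by apply/funext => k; rewrite intS addrA.
  have [c1 s1] := sumZ_shift1 IHc.
  by split; [exact: c1 | rewrite s1].
- have [c1 s1] := sumZ_reflect IHc.
  have [c2 s2] := sumZ_shift1 c1.
  have [c3 s3] := sumZ_reflect c2.
  have -> : (fun k : int => u (k - n.+1%:Z)) =
      (fun k => u (- (- k - 1 + 1) - 1 - n%:Z)).
    by apply/funext => k; congr u; rewrite intS; ring.
  by split; [exact: c3 | rewrite s3 s2 s1].
Qed.

End two_sided_series_shift.

Section windows.
Context {R : realType}.
Implicit Types u : int -> R.

(** The index set of the [N]-th partial sums of both halves of a series: it runs
    from [- N] to [N - 1], hence is not symmetric about 0. *)
Definition window (N : nat) : seq int :=
  map Posz (iota 0 N) ++ map Negz (iota 0 N).

Lemma mem_window N (k : int) :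
  (k \in window N) = if k is Posz n then (n < N)%N else (absz k <= N)%N.
Proof.
rewrite mem_cat; case: k => n.
- rewrite mem_map ?mem_iota; last by move=> ? ? [].
  by rewrite [X in _ || X](_ : _ = false) ?orbF//; apply/negP => /mapP[].
- rewrite orbC mem_map ?mem_iota; last by move=> ? ? [].
  by rewrite [X in _ || X](_ : _ = false) ?orbF//; apply/negP => /mapP[].
Qed.

Lemma window_uniq N : uniq (window N).
Proof.
rewrite cat_uniq !map_inj_uniq ?iota_uniq//=; try by move=> ? ? [].
by rewrite andbT; apply/hasPn => _ /mapP[n _ ->]; apply/mapP => -[].
Qed.

Lemma window_sub N M : (N <= M)%N -> {subset window N <= window M}.
Proof.
move=> NM k; rewrite !mem_window; case: k => n kN; exact: leq_trans NM.
Qed.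

Lemma in_some_window (k : int) : exists N, k \in window N.
Proof.
exists `|k|.+1; rewrite mem_window.
by case: k => n //=; rewrite ltnW.
Qed.

Lemma sum_window N u : \sum_(k <- window N) u k =
  series (u \o Posz) N + series (u \o Negz) N.
Proof. by rewrite big_cat !big_map /series/= /index_iota subn0. Qed.

Lemma sum_window_cvg u : cvgZ u ->
  \sum_(k <- window N) u k @[N --> \oo] --> sumZ u.
Proof.
by move=> [u1 u2]; under eq_fun do rewrite sum_window; exact: cvgD.
Qed.

Lemma sumZ_window N u : (forall k, k \notin window N -> u k = 0) ->
  cvgZ u /\ sumZ u = \sum_(k <- window N) u k.
Proof.
move=> u0.
have cu : cvgZ u.
  apply: (@cvgZ_fin _ N.+1) => k Nk; apply: u0; rewrite mem_window.
  by case: k Nk => n Nk; rewrite -?leqNgt -?ltnNge// ltnW.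
split=> //; apply: (cvg_unique _ (sum_window_cvg cu)) => //.
apply: cvg_near_cst; near=> M.
have NM : (N <= M)%N by near: M; exact: nbhs_infty_ge.
rewrite (bigID (mem (window N)))/= [X in _ + X]big1 ?addr0; last first.
  by move=> k /u0.
rewrite -big_filter; apply: perm_big; apply: uniq_perm.
- exact/filter_uniq/window_uniq.
- exact: window_uniq.
- move=> k; rewrite mem_filter; apply: andb_idr; exact: window_sub.
Unshelve. all: by end_near. Qed.

Lemma sumZ1 (k : int) u : (forall j, j != k -> u j = 0) -> sumZ u = u k.
Proof.
move=> u0; have [N kN] := in_some_window k.
have [j jN|_ ->] := @sumZ_window N u.
  by apply: u0; apply: contraNneq jN => ->.
by rewrite (bigD1_seq k)//= ?window_uniq// big1 ?addr0.
Qed.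

End windows.

(** * Shifts, multipliers and truncations on l^2 *)

Section ell2_operations.
Context {R : realType}.
Implicit Types (f g : ell2 R) (u v : int -> R[i]).

Lemma ell2_in f : (f : int -> R[i]) \in @ell2_pred R.
Proof. by rewrite inE; exact: ell2P. Qed.

Lemma ell2_ext f g : (forall k, f k = g k) -> f = g.
Proof. by move=> fg; apply/val_inj/funext. Qed.

Lemma ell2D f g k : (f + g) k = f k + g k. Proof. by []. Qed.

Lemma ell2B f g k : (f - g) k = f k - g k. Proof. by []. Qed.

Lemma ell2Z (c : R[i]) f k : (c *: f) k = c * f k. Proof. by []. Qed.

Lemma ell2_pred_ex u : u \in ell2_pred -> exists f : ell2 R, u = f.
Proof. by move=> uP; exists (Ell2 uP). Qed.

Lemma ell2_pred_shift (m : int) u :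
  u \in ell2_pred -> (fun k => u (k + m)) \in ell2_pred.
Proof. by rewrite !inE => /(@sumZ_shift R m)[]. Qed.

Lemma normc_real_mul (c : R) (z : R[i]) : normc (c%:C * z) = `|c| * normc z.
Proof. by rewrite normcM /= expr0n /= addr0 sqrtr_sqr. Qed.

Lemma ell2_pred_contract (m : int -> R) u : (forall k, `|m k| <= 1) ->
  u \in ell2_pred -> (fun k => (m k)%:C * u k) \in ell2_pred.
Proof.
rewrite !inE => m1 uP; apply: cvgZ_dom uP => k.
rewrite normc_real_mul exprMn ger0_norm; last by rewrite mulr_ge0 ?sqr_ge0.
by rewrite ler_piMl ?sqr_ge0// exprn_ile1.
Qed.

Lemma ell2_dot_e f k : ell2_dot f (ell2_e k) = f k.
Proof.
have dE j : f j * (ell2_e k j)^* = if j == k then f k else 0.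
  rewrite /= /delta; case: eqP => [->|_].
    by rewrite [X in _ * X]conjc1 mulr1.
  by rewrite [X in _ * X]conjc0 mulr0.
rewrite /ell2_dot /sumZc; under eq_fun do rewrite dE.
under [X in _ +i* sumZ X]eq_fun do rewrite dE.
rewrite (@sumZ1 _ k) => [|j /negPf ->//].
rewrite (@sumZ1 _ k) => [|j /negPf ->//].
by rewrite eqxx; case: (f k).
Qed.

Lemma ell2_normE f : `|f| = (Num.sqrt (sumZ (fun k => normc (f k) ^+ 2)))%:C.
Proof.
rewrite -[LHS]/(sqrtC (ell2_dot f f)) ell2_dotE.
have S0 : 0 <= sumZ (fun k => normc (f k) ^+ 2).
  by apply: le_trans (sumZ_ge 0 _ (ell2P f)) => *; exact: sqr_ge0.
by rewrite -{1}(sqr_sqrtr S0) rmorphXn sqrCK// lecR sqrtr_ge0.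
Qed.

Lemma ell2_dot_le f g : `|ell2_dot f g| <= `|f| * `|g|.
Proof. exact: dot_CauchySchwarz. Qed.

(** A relation [<x, f> = <y, g>] between the components of a pair [(x, y)] is
    the vanishing of a bounded functional, so it passes from a set to its
    closure.  It is used both for graphs (with [f], [g] coming from basis
    vectors) and for symmetry. *)
Lemma closure_dot (A : set (ell2 R * ell2 R)) f g :
  (forall p, A p -> ell2_dot p.1 f = ell2_dot p.2 g) ->
  forall p, closure A p -> ell2_dot p.1 f = ell2_dot p.2 g.
Proof.
move=> A0 p Ap; apply/eqP; rewrite -subr_eq0; apply: contrapT => /negP z0.
set z := _ - _ in z0.
(* The summand 1 makes the denominator positive and the final bound strict. *)
pose e := `|z| / (`|f| + `|g| + 1).
have e0 : 0 < e by rewrite divr_gt0 ?normr_gt0// ltr_wpDl ?addr_ge0.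
have c1 : fst p' @[p' --> p] --> p.1.
  by case: (p) => a b; exact: cvg_fst.
have c2 : snd p' @[p' --> p] --> p.2.
  by case: (p) => a b; exact: cvg_snd.
have [p' [Ap' [p1 p2]]] :
    A `&` [set p' | `|p.1 - p'.1| < e /\ `|p.2 - p'.2| < e] !=set0.
  apply: Ap; near=> p'; split; near: p'.
  - by move/cvgrPdist_lt: c1; apply.
  - by move/cvgrPdist_lt: c2; apply.
have : `|z| < `|z|.
  have {1}-> : z = ell2_dot (p.1 - p'.1) f - ell2_dot (p.2 - p'.2) g.
    by rewrite !linearBl/= (A0 _ Ap') /z; ring.
  apply: le_lt_trans (ler_normB _ _) _.
  apply: (@le_lt_trans _ _ (e * `|f| + e * `|g|)).
    by apply: lerD; apply: le_trans (ell2_dot_le _ _) _;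
      rewrite ler_wpM2r// ltW.
  rewrite -mulrDr /e mulrAC -mulrA gtr_pMr ?normr_gt0//.
  by rewrite ltr_pdivrMr ?mul1r ?ltrDl// ltr_wpDl ?addr_ge0.
by rewrite ltxx.
Unshelve. all: by end_near. Qed.

Definition ell2_truncate f N : ell2 R := \sum_(k <- window N) f k *: ell2_e k.

Lemma ell2_truncateE f N k :
  ell2_truncate f N k = if k \in window N then f k else 0.
Proof.
have := ell2_sumE [seq (f k, k) | k <- window N] k.
rewrite !big_map => ->.
case: ifPn => kN.
  rewrite (bigD1_seq k)//= ?window_uniq// eqxx mulr1 big1 ?addr0// => j jk.
  by rewrite eq_sym (negPf jk) mulr0.
rewrite big_seq big1// => j jN; case: eqP => [kj|_]; last by rewrite mulr0.
by rewrite kj jN in kN.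
Qed.

Lemma finite_combinations_truncate f N : finite_combinations (ell2_truncate f N).
Proof. by exists [seq (f k, k) | k <- window N]; rewrite big_map. Qed.

Lemma ell2_truncate_cvg f : ell2_truncate f N @[N --> \oo] --> f.
Proof.
apply/cvgrPdist_lt => e e0.
(* Elements of R[i] compare only when their imaginary parts agree, so the
   positive bound [e] is real. *)
have eE : e = (complex.Re e)%:C.
  by case: e e0 => x y; rewrite ltcE/= => /andP[/eqP -> _].
have r0 : 0 < complex.Re e by rewrite eE ltcR in e0.
have := sum_window_cvg (ell2P f).
move/cvgrPdist_lt => /(_ _ (exprn_gt0 2 r0)).
apply: filterS => N.
rewrite ell2_normE eE ltcR.
set n := fun k => normc (f k) ^+ 2.
pose w k := if k \in window N then n k else 0.
have [|cw sw] := @sumZ_window _ N w; first by move=> k /negPf kN; rewrite /w kN.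
have -> : (fun k => normc ((f - ell2_truncate f N) k) ^+ 2) =
    (fun k => -1 * w k + n k).
  apply/funext => k; rewrite ell2B ell2_truncateE /w mulN1r; case: ifP => _.
    by rewrite subrr addNr normc0 expr0n.
  by rewrite subr0 oppr0 add0r.
rewrite (sumZ_lin _ cw (ell2P f)) sw mulN1r addrC.
have -> : \sum_(k <- window N) w k = \sum_(k <- window N) n k.
  by rewrite !big_seq; apply: eq_bigr => k kN; rewrite /w kN.
move=> /(le_lt_trans (ler_norm _)); rewrite -/n addrC.
set x := _ + _ => lt_r.
rewrite -(ltr_pXn2r (n := 2)) ?nnegrE ?sqrtr_ge0 ?(ltW r0)//.
have [x0|x0] := leP 0 x; first by rewrite sqr_sqrtr.
by rewrite ler0_sqrtr ?expr0n ?exprn_gt0// ltW.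
Qed.

Definition ell2_shift (m : int) f : ell2 R :=
  Ell2 (ell2_pred_shift m (ell2_in f)).

Lemma ell2_shift_norm m f : `|ell2_shift m f| = `|f|.
Proof. by rewrite !ell2_normE; have [_ <-] := sumZ_shift m (ell2P f). Qed.

Lemma ell2_shift_cvg m (f_ : nat -> ell2 R) f :
  f_ N @[N --> \oo] --> f -> ell2_shift m (f_ N) @[N --> \oo] --> ell2_shift m f.
Proof.
move=> /cvgrPdist_lt ff; apply/cvgrPdist_lt => e /ff; apply: filterS => N.
have -> : ell2_shift m f - ell2_shift m (f_ N) = ell2_shift m (f - f_ N).
  exact: ell2_ext.
by rewrite ell2_shift_norm.
Qed.

End ell2_operations.

(** * The a priori estimate for the three-term formula *)

Lemma op0 (R : realType) (T : operator R) : T 0 = 0.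
Proof.
have := op_lin (-1) (dom0 T) (dom0 T).
by rewrite scaler0 addr0 scaleN1r addNr.
Qed.

Section jacobi_operator.
Context {R : realType}.
Variables q t : R.
Hypotheses (q0 : 0 < q) (t0 : 0 < t).
Implicit Types f g : ell2 R.

Local Notation J := (jacobi q t).

Definition jacobi_weight (k : int) : R := (Num.sqrt (t * q ^ k))^-1.
Local Notation d := jacobi_weight.

Lemma jacobi_weight_gt0 k : 0 < d k.
Proof. by rewrite invr_gt0 sqrtr_gt0 mulr_gt0// exprz_gt0. Qed.

Lemma jacobi_weightS k : d (k + 1) = (Num.sqrt q)^-1 * d k.
Proof.
rewrite /d expfzDr ?gt_eqF// expr1z mulrA sqrtrM ?invfM//.
  by rewrite mulrC.
by rewrite ltW// mulr_gt0// exprz_gt0.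
Qed.

Lemma jacobi_bE k : jacobi_b q t k = - d k ^+ 2.
Proof.
rewrite /jacobi_b /d exprVn sqr_sqrtr//.
by rewrite ltW// mulr_gt0// exprz_gt0.
Qed.

(** The three-term formula makes sense on every sequence; its values on l^2 need
    not lie in l^2. *)
Definition jacobi_formula (f : int -> R[i]) (k : int) : R[i] :=
  (d (k + 1))%:C * f (k + 1) + (d k)%:C * f (k - 1) - (d k ^+ 2)%:C * f k.

Lemma ell2_dot_jacobi_e f k : ell2_dot f (jacobi_e q t k) = jacobi_formula f k.
Proof.
rewrite /jacobi_e !linearDr/= !linearZr_LR/= !ell2_dot_e.
rewrite /jacobi_a subrK jacobi_bE -/(d k) -/(d (k + 1)).
have cC (x : R) : (x%:C)^*%R = x%:C.
  by congr (_ +i* _); rewrite oppr0.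
by rewrite !cC /jacobi_formula rmorphN mulNr addrAC.
Qed.

Lemma jacobi_e_sym j k :
  ell2_dot (ell2_e j) (jacobi_e q t k) = ell2_dot (jacobi_e q t j) (ell2_e k).
Proof.
rewrite ell2_dot_jacobi_e ell2_dot_e /jacobi_formula.
rewrite -[jacobi_e q t j k]/((jacobi_a q t j)%:C * (k == j + 1)%:R
  + (jacobi_b q t j)%:C * (k == j)%:R
  + (jacobi_a q t (j - 1))%:C * (k == j - 1)%:R).
rewrite -[ell2_e j _]/(_ == j)%:R -[ell2_e j (k - 1)]/(_ == j)%:R.
rewrite -[ell2_e j k]/(_ == j)%:R.
rewrite /jacobi_a subrK jacobi_bE -/(d j) -/(d (j + 1)).
rewrite subr_eq [k == j - 1]eq_sym subr_eq [j == k + 1]eq_sym.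
rewrite rmorphN mulNr [RHS]addrAC [_ + (d j)%:C * _]addrC.
congr (_ + _ - _); first 1 last.
- by case: eqP => [->|_]; rewrite ?addrK// !mulr0.
- by case: eqP => [->//|_]; rewrite !mulr0.
- by case: eqP => [->//|_]; rewrite !mulr0.
Qed.

(** Both sides are linear in [f]: this reduces a transfer of [J] across the
    inner product to basis vectors. *)
Lemma jacobi_finite_transfer g h :
  (forall k, ell2_dot (ell2_e k) h = ell2_dot (jacobi_e q t k) g) ->
  forall f, finite_combinations f -> ell2_dot f h = ell2_dot (J f) g.
Proof.
move=> ek _ [s ->]; elim: s => [|p s IH].
  by rewrite big_nil op0 !linear0l.
have fs : finite_combinations (\sum_(p <- s) p.1 *: ell2_e p.2 : ell2 R).
  by exists s.
rewrite big_cons op_lin//; last exact: finite_combinations_e.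
by rewrite jacobi_ell2_e !linearDl/= !linearZl_LR/= IH ek.
Qed.

Lemma jacobi_finiteE f k : finite_combinations f ->
  ell2_dot f (jacobi_e q t k) = ell2_dot (J f) (ell2_e k).
Proof.
by apply: jacobi_finite_transfer => j; exact: jacobi_e_sym.
Qed.

(** Adding [d k f k] to the formula solved for [d k ^ 2 f k] and dividing by
    [1 + d k] expresses [d f] through [f], its shifts and [g], with multipliers
    that stay at most 1 both where [d k] is large and where it is small. *)
Lemma jacobi_weight_ell2 f g : (forall k, g k = jacobi_formula f k) ->
  (fun k => (d k)%:C * f k) \in ell2_pred.
Proof.
move=> gf.
pose r := (Num.sqrt q)^-1.
pose h := (f : int -> R[i]) + r%:C *: (fun k => f (k + 1)) + (fun k => f (k - 1)).
have d1 k : 0 < 1 + d k by rewrite ltr_wpDr// ltW// jacobi_weight_gt0.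
have -> : (fun k => (d k)%:C * f k) =
  (fun k => (d k / (1 + d k))%:C * h k) - (fun k => ((1 + d k)^-1)%:C * g k).
  apply/funext => k.
  rewrite -[RHS]/((d k / (1 + d k))%:C * (f k + r%:C * f (k + 1) + f (k - 1))
    - ((1 + d k)^-1)%:C * g k).
  rewrite gf /jacobi_formula jacobi_weightS -/r !(rmorphM, rmorphXn)/=.
  have : (1 + d k)%:C * ((1 + d k)^-1)%:C = 1 by rewrite -rmorphM divff// gt_eqF.
  rewrite rmorphD/=; set i := (_^-1)%:C => iE.
  by rewrite -[LHS]mul1r -iE; ring.
apply: rpredB; apply: ell2_pred_contract.
- move=> k; rewrite gtr0_norm ?divr_gt0 ?jacobi_weight_gt0//.
  by rewrite ler_pdivrMr// mul1r ler_wpDl.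
- by rewrite !rpredD ?rpredZ ?ell2_pred_shift ?ell2_in.
- move=> k; rewrite gtr0_norm ?invr_gt0// invf_le1//.
  by rewrite lerDl ltW// jacobi_weight_gt0.
- exact: ell2_in.
Qed.

(** The off-diagonal terms of the formula are shifts of [d f] up to the constant
    [d k / d (k - 1)], so the diagonal term [d^2 f] is what remains of [g]. *)
Lemma jacobi_weight2_ell2 f g : (forall k, g k = jacobi_formula f k) ->
  (fun k => (d k ^+ 2)%:C * f k) \in ell2_pred.
Proof.
move=> gf; have df := jacobi_weight_ell2 gf.
have -> : (fun k => (d k ^+ 2)%:C * f k) =
  (fun k => (d (k + 1))%:C * f (k + 1))
  + (Num.sqrt q)^-1%:C *: (fun k => (d (k - 1))%:C * f (k - 1)) - g.
  apply/funext => k.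
  rewrite -[RHS]/((d (k + 1))%:C * f (k + 1)
    + (Num.sqrt q)^-1%:C * ((d (k - 1))%:C * f (k - 1)) - g k).
  by rewrite mulrA -rmorphM -jacobi_weightS subrK gf /jacobi_formula; ring.
rewrite rpredB ?rpredD ?rpredZ ?ell2_in//.
- exact: (ell2_pred_shift 1 df).
- exact: (ell2_pred_shift (-1) df).
Qed.

(** Truncation commutes with multiplication by [d] and [d^2], so [J] of the
    truncations of [f] is a continuous function [T] of the truncations of [d f]
    and [d^2 f], two elements of l^2. *)
Lemma maximal_sub_closure f g : (forall k, g k = jacobi_formula f k) ->
  closure (graph J) (f, g).
Proof.
move=> gf.
have [df dfE] := ell2_pred_ex (jacobi_weight_ell2 gf).
have [d2f d2fE] := ell2_pred_ex (jacobi_weight2_ell2 gf).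
pose r := (Num.sqrt q)^-1.
pose T (u v : ell2 R) := ell2_shift 1 u + r%:C *: ell2_shift (-1) u - v.
have truncE (u : int -> R) (h v : ell2 R) N : (fun k => (u k)%:C * h k) = v ->
    forall k, (u k)%:C * ell2_truncate h N k = ell2_truncate v N k.
  move=> uv k; rewrite !ell2_truncateE; case: ifP; rewrite ?mulr0// -uv//.
have formulaE (h u v : ell2 R) : (forall k, (d k)%:C * h k = u k) ->
    (forall k, (d k ^+ 2)%:C * h k = v k) -> jacobi_formula h =1 T u v.
  move=> hu hv k; rewrite -[RHS]/(u (k + 1) + r%:C * u (k - 1) - v k).
  rewrite -!hu -hv /jacobi_formula [_%:C * (_ * _)]mulrA -rmorphM.
  by rewrite -jacobi_weightS subrK.
have gT : g = T df d2f.
  apply: ell2_ext => k; rewrite gf; apply: formulaE => j.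
    by rewrite -dfE.
  by rewrite -d2fE.
have JT N : J (ell2_truncate f N) = T (ell2_truncate df N) (ell2_truncate d2f N).
  apply: ell2_ext => k; rewrite -ell2_dot_e.
  rewrite -jacobi_finiteE; last exact: finite_combinations_truncate.
  by rewrite ell2_dot_jacobi_e; apply: formulaE; exact: truncE.
have cJ : (ell2_truncate f N, J (ell2_truncate f N)) @[N --> \oo] --> (f, g).
  apply: (@cvg_pair _ _ _ \oo (nbhs f) (nbhs g)); first exact: ell2_truncate_cvg.
  rewrite gT; under eq_fun do rewrite JT.
  apply: cvgB; last exact: ell2_truncate_cvg.
  have shiftT m (h : ell2 R) :
      ell2_shift m (ell2_truncate h N) @[N --> \oo] --> ell2_shift m h.
    by apply: ell2_shift_cvg; exact: ell2_truncate_cvg.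
  by apply: cvgD => //; apply: cvgZl_tmp.
apply: (closed_cvg _ (@closed_closure _ _) _ _ cJ).
near=> N; apply: subset_closure; split => //=.
exact: finite_combinations_truncate.
Unshelve. all: by end_near. Qed.

(** The formula at [k] says [<f, J e_k> = <g, e_k>], which holds on the graph of
    [J] and is preserved by closure; the converse is the truncation argument. *)
Lemma closure_jacobiP f g :
  closure (graph J) (f, g) <-> forall k, g k = jacobi_formula f k.
Proof.
split; last exact: maximal_sub_closure.
move=> fg k; rewrite -ell2_dot_jacobi_e -ell2_dot_e; apply/esym.
apply: (@closure_dot _ (graph J)) fg => -[a b] [/= Da ->].
exact: jacobi_finiteE.
Qed.

End jacobi_operator.

(** * The closure of J is self-adjoint *)

Section jacobi_closure.
Context {R : realType}.
Variables q t : R.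
Hypotheses (q0 : 0 < q) (t0 : 0 < t).
Implicit Types f g : ell2 R.

Local Notation J := (jacobi q t).

Definition jacobi_max_dom : set (ell2 R) :=
  [set f | jacobi_formula q t f \in ell2_pred].

Definition jacobi_max_fun f : ell2 R :=
  insubd (0 : ell2 R) (jacobi_formula q t f).

Lemma jacobi_max_funE f : jacobi_max_dom f ->
  (jacobi_max_fun f : int -> R[i]) = jacobi_formula q t f.
Proof. exact: insubdK. Qed.

Lemma jacobi_formula_lin (c : R[i]) f g :
  jacobi_formula q t (c *: f + g) =
  c *: jacobi_formula q t f + jacobi_formula q t g.
Proof.
apply/funext => k.
rewrite -[RHS]/(c * jacobi_formula q t f k + jacobi_formula q t g k).
by rewrite /jacobi_formula !(ell2D, ell2Z); ring.
Qed.

Lemma jacobi_max_dom_lin (c : R[i]) f g : jacobi_max_dom f ->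
  jacobi_max_dom g -> jacobi_max_dom (c *: f + g).
Proof.
by rewrite /jacobi_max_dom/= jacobi_formula_lin => ? ?; rewrite rpredD ?rpredZ.
Qed.

Lemma jacobi_max_dom0 : jacobi_max_dom 0.
Proof.
have := jacobi_formula_lin (-1) 0 0; rewrite scaler0 addr0 scaleN1r addNr.
by rewrite /jacobi_max_dom/= => ->; exact: rpred0.
Qed.

Lemma jacobi_max_fun_lin (c : R[i]) f g : jacobi_max_dom f ->
  jacobi_max_dom g ->
  jacobi_max_fun (c *: f + g) = c *: jacobi_max_fun f + jacobi_max_fun g.
Proof.
move=> Df Dg; apply/val_inj => /=.
by rewrite !jacobi_max_funE ?jacobi_formula_lin//; exact: jacobi_max_dom_lin.
Qed.

Definition jacobi_max : operator R :=
  Operator jacobi_max_dom0 jacobi_max_dom_lin jacobi_max_fun_lin.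

Lemma graph_jacobi_maxP f g :
  graph jacobi_max (f, g) <-> forall k, g k = jacobi_formula q t f k.
Proof.
split=> [[/= Df ->] k|gf]; first by rewrite jacobi_max_funE.
have Ef : (g : int -> R[i]) = jacobi_formula q t f by apply/funext.
have Df : jacobi_max_dom f by rewrite /jacobi_max_dom/= -Ef ell2_in.
by split => //=; apply: ell2_ext => k; rewrite jacobi_max_funE.
Qed.

Lemma jacobi_max_closure : is_closure J jacobi_max.
Proof.
apply/seteqP; split=> -[f g].
  by move/graph_jacobi_maxP; exact: (maximal_sub_closure q0 t0).
by move/(closure_jacobiP q0 t0)/graph_jacobi_maxP.
Qed.

Lemma jacobi_graph_max f : dom J f -> graph jacobi_max (f, J f).
Proof.
by move=> Df; rewrite jacobi_max_closure; apply: subset_closure.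
Qed.

Lemma jacobi_max_sym_e f k : dom jacobi_max f ->
  ell2_dot (ell2_e k) (jacobi_max f) = ell2_dot (jacobi_e q t k) f.
Proof.
move=> Df; rewrite ell2_dotC [RHS]ell2_dotC ell2_dot_e ell2_dot_jacobi_e//.
by have /graph_jacobi_maxP -> : graph jacobi_max (f, jacobi_max f) by [].
Qed.

(** By linearity the identity holds for [f] in the domain of [J]; every point of
    the graph of the maximal operator is a limit of such points. *)
Lemma jacobi_max_sym f g : dom jacobi_max f -> dom jacobi_max g ->
  ell2_dot (jacobi_max f) g = ell2_dot f (jacobi_max g).
Proof.
move=> Df Dg.
have : closure (graph J) (f, jacobi_max f) by rewrite -jacobi_max_closure.
move/closure_dot => /(_ (jacobi_max g) g) /= -> // -[a b] [/= Da ->].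
by apply: jacobi_finite_transfer Da => k; exact: jacobi_max_sym_e.
Qed.

Lemma dense_finite_combinations : dense (@finite_combinations R).
Proof.
move=> O [f Of] oO.
have : \forall N \near \oo, O (ell2_truncate f N).
  by apply: (@ell2_truncate_cvg R f); exact: open_nbhs_nbhs.
move=> [N _ /(_ N (leqnn N)) ON]; exists (ell2_truncate f N).
by split => //; exact: finite_combinations_truncate.
Qed.

Lemma jacobi_max_dense : densely_defined jacobi_max.
Proof.
move=> O O0 oO; have [f [Of Df]] := dense_finite_combinations O0 oO.
by exists f; split => //; have [] := jacobi_graph_max Df.
Qed.

(** Testing a pair of the adjoint graph against the basis vectors alone already
    gives the three-term formula, so the adjoint is not larger than the maximal
    operator. *)
Lemma jacobi_max_self_adjoint : self_adjoint jacobi_max.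
Proof.
split; first exact: jacobi_max_dense.
apply/seteqP; split=> -[f g].
  by move=> [/= Df ->] h Dh /=; exact: jacobi_max_sym.
move=> adj; apply/graph_jacobi_maxP => k.
have [De Ee] := jacobi_graph_max (finite_combinations_e k).
have Ek : jacobi_max (ell2_e k) = jacobi_e q t k.
  by rewrite -jacobi_ell2_e; exact/esym.
have := adj _ De; rewrite Ek /=.
rewrite ell2_dotC [RHS]ell2_dotC ell2_dot_e ell2_dot_jacobi_e// !mul1r.
by move/(inv_inj (@conjCK _)).
Qed.

Lemma jacobi_symmetric : symmetric_op J.
Proof.
split=> [|f g Df Dg]; first exact: dense_finite_combinations.
have [Mf /= ->] := jacobi_graph_max Df; have [Mg /= ->] := jacobi_graph_max Dg.
exact: jacobi_max_sym.
Qed.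

End jacobi_closure.

Theorem theorem3p1 (R : realType) (q t : R) (hq0 : 0 < q) (hq1 : q < 1)
  (ht : 0 < t) : essentially_self_adjoint (jacobi q t).
Proof.
split; first exact: jacobi_symmetric.
exists (jacobi_max q t).
by split; [exact: jacobi_max_closure | exact: jacobi_max_self_adjoint].
Qed.
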